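(* For integers $s,t\ge 4$, $$r_{pot}(K_s,K_{1,t-1})=\begin{cases}2s, & \text{if } t<s+2,\\ t+s-2, & \text{otherwise.}\end{cases}$$
   Context: All graphs are finite and simple. A sequence of nonnegative integers $\pi=(d_1,\dots,d_n)$ (written in nonincreasing order) is graphic if some graph of order $n$ has degree sequence $\pi$; such a graph is a realization of $\pi$. For a graph $H$, a graphic sequence $\pi$ is potentially $H$-graphic if some realization of $\pi$ contains $H$ as a subgraph. For an $N$-term graphic sequence $\pi=(d_1,\dots,d_N)$, its complementary sequence is $\overline{\pi}=(N-1-d_N,\dots,N-1-d_1)$. For graphs $H_1,H_2$, the potential-Ramsey number $r_{pot}(H_1,H_2)$ is the minimum integer $N$ such that for every $N$-term graphic sequence $\pi$, either $\pi$ is potentially $H_1$-graphic or $\overline{\pi}$ is potentially $H_2$-graphic. $K_s$ is the complete graph on $s$ vertices and $K_{1,t-1}$ is the star with $t-1$ leaves. *)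

(* Defs.v *)
From mathcomp Require Import all_boot.
Set Implicit Arguments. Unset Strict Implicit. Unset Printing Implicit Defensive.

Definition simple_graph (V : finType) (e : rel V) : Prop :=
  (forall x y, e x y = e y x) /\ (forall x, ~~ e x x).

Definition deg (V : finType) (e : rel V) (x : V) : nat := #|[pred y | e x y]|.

Definition realizes (N : nat) (e : rel 'I_N) (pi : seq nat) : Prop :=
  size pi = N /\ simple_graph e /\ forall i : 'I_N, deg e i = nth 0 pi i.

Definition graphic (N : nat) (pi : seq nat) : Prop :=
  size pi = N /\ sorted geq pi /\ exists e : rel 'I_N, realizes e pi.

Definition subgraph (W V : finType) (h : rel W) (e : rel V) : Prop :=
  exists f : W -> V, injective f /\ forall u v, h u v -> e (f u) (f v).

Definition potentially (W : finType) (h : rel W) (N : nat) (pi : seq nat) : Prop :=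
  graphic N pi /\ exists e : rel 'I_N, realizes e pi /\ subgraph h e.

Definition compl_seq (N : nat) (pi : seq nat) : seq nat :=
  rev (map (fun d => N.-1 - d) pi).

(* complete graph K_s and star K_{1,t-1} (centre 0, t vertices) *)
Definition complete_graph (s : nat) : rel 'I_s := fun x y => x != y.
Definition star_graph (t : nat) : rel 'I_t :=
  fun x y => (x != y) && ((val x == 0) || (val y == 0)).

Definition rpot_prop (W1 W2 : finType) (h1 : rel W1) (h2 : rel W2) (N : nat) : Prop :=
  forall pi : seq nat, graphic N pi ->
    potentially h1 N pi \/ potentially h2 N (compl_seq N pi).

Definition is_rpot (W1 W2 : finType) (h1 : rel W1) (h2 : rel W2) (r : nat) : Prop :=
  rpot_prop h1 h2 r /\ forall N, rpot_prop h1 h2 N -> r <= N.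
Arguments complete_graph s : clear implicits.
Arguments star_graph t : clear implicits.

(* Main.v *)
Require Import Defs.
From mathcomp Require Import all_boot all_order all_algebra.
From mathcomp Require Import zify ring.
Set Implicit Arguments. Unset Strict Implicit. Unset Printing Implicit Defensive.
Import Order.TTheory GRing.Theory Num.Theory.
Local Open Scope ring_scope.

(** Upper bound: if a vertex of a realization has at least t-1 non-neighbours,
    the complement contains the star; otherwise all degrees are at least s-1, on
    at least 2s vertices, and it suffices to find a realization in which the set
    A of the s vertices of largest degree is a clique.  This is first done for
    0/1 matrices with zero diagonal whose row and column sums are the degrees,
    symmetric or not: as long as an entry in A x A vanishes, either an
    alternating path increases the number of ones in A x A, or the rows and
    columns reachable from that entry form a cut contradicting the degree
    conditions.  Half the sum of such a matrix and its transpose is a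
    half-integral realization with A complete; its entries 1/2 form an even
    graph, which is rounded by alternating closed trails: even ones directly,
    odd ones in pairs, joined through two vertices outside A.

    Lower bound: for N <= t+s-3, join a clique on at most s-2 vertices
    completely to an independent set on at most t-1 vertices; for N < 2s, take
    the complement of a cycle, in which a clique of size s would have 2s
    non-edges to the N-s remaining vertices, each of which meets only two. *)

(** * Cuts of 0/1 matrices with given margins *)

(* Numerical content of a cut: [sg], [al] and [w], [j], [u] are the sizes of its
   classes in A and outside A, [X], [Y], [Z] the degree sums over the classes of
   sizes [sg], [w], [j], and [mu] separates the degrees inside and outside A. *)
Lemma deficient_cut_absurd (sg al w j u s mu X Y Z : int) :
  0 <= sg -> 0 <= al -> 0 <= w -> 0 <= j -> 0 <= u ->
  al + sg <= s -> s <= w + j + u -> s - 1 <= mu ->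
  sg * mu <= X -> Y <= w * mu -> j * (s - 1) <= Z ->
  X - Y + Z <= sg * (s - 1) - w * (w - 1 + s - sg + u) + al * j - 1 ->
  X <= sg * (s - 1 + w) - 1 -> False.
Proof.
move=> sg0 al0 w0 j0 u0 alsg sB smu X_ge Y_le Z_ge cut1 cut2.
(* The bound on [X] is strict after dividing by [sg], and [sg] is positive because [sg = 0] would
   give both [0 <= X] and [X <= -1]. *)
have mu_lt : mu < s - 1 + w by nia.
have sg1 : 1 <= sg by nia.
have Z_al : j * (sg - 1) <= Z - al * j by nia.
(* In terms of the excess [nu < w] of [mu] over [s - 1], the first cut inequality loses its terms in
   [s - 1]. *)
have [nu nuE] : exists nu, nu = mu - (s - 1) by eexists.
have key : (sg - w) * nu <= - (w * (w - sg + u)) - j * (sg - 1) - 1 by nia.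
(* If [sg <= w], then [nu <= w - 1] makes the left side of [key] too large. Otherwise that side is
   nonnegative, while [sg <= s <= w + j + u] keeps the right side negative. *)
case: (lerP sg w) => [sgw | wsg].
- have : (w - sg) * nu <= (w - sg) * (w - 1) by nia.
  have : 0 <= w * u by nia.
  have : 0 <= j * (sg - 1) by nia.
  nia.
- have : 0 <= (sg - w) * nu by nia.
  have : j * w <= j * (sg - 1) by nia.
  nia.
Qed.

Lemma sum_delta (V : finType) (f : V -> int) :
  \sum_x \sum_y ((x == y)%:Z * f x) = \sum_x f x.
Proof.
apply: eq_bigr => x _; rewrite (bigD1 x) //= eqxx mul1r big1 ?addr0 // => y yx.
by rewrite eq_sym (negbTE yx) mul0r.
Qed.

Lemma sum_prod (V : finType) (f g : V -> int) :
  \sum_x \sum_y (f x * g y) = (\sum_x f x) * (\sum_y g y).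
Proof. by rewrite big_distrlr. Qed.

(** Symmetry is deliberately absent: [M] is a loopless digraph, so that single ones may be moved;
    symmetry is restored later. *)
Definition margins (V : finType) (d : V -> int) (M : rel V) : Prop :=
  [/\ forall x, ~~ M x x, forall x, \sum_y (M x y)%:Z = d x
    & forall y, \sum_x (M x y)%:Z = d y].

(** Rows and columns have the same margins, so a weight split into a row part and a column part sees
    only the degrees. This turns degree sums into sums over entries, which can be bounded one by
    one. *)
Lemma sum_row_col (V : finType) (d : V -> int) (M : rel V) (f g : V -> int) :
  margins d M ->
  \sum_x \sum_y ((f x + g y) * (M x y)%:Z) = \sum_x (f x + g x) * d x.
Proof.
case=> _ rows cols.
under eq_bigr do under eq_bigr do rewrite mulrDl.
under eq_bigr do rewrite big_split /=.
rewrite big_split /= [X in _ + X]exchange_big /= -big_split /=.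
apply: eq_bigr => x _; rewrite -2!mulr_sumr rows cols.
by rewrite mulrDl.
Qed.

(** Entries are compared together with their transposes. Summing over all pairs counts each total
    twice, and the strict pair is met as [(u, v)] and as [(v, u)], so one unit remains after
    halving. *)
Lemma sum_pair_le (V : finType) (F G : V -> V -> int) (u v : V) :
  u != v ->
  (forall x y, F x y + F y x <= G x y + G y x) ->
  F u v + F v u <= G u v + G v u - 1 ->
  \sum_x \sum_y F x y <= \sum_x \sum_y G x y - 1.
Proof.
move=> uv le_all lt_uv.
pose D x y : int := ((x == u) && (y == v))%:Z.
have DE : \sum_x \sum_y D x y = 1.
  rewrite (bigD1 u) //= (bigD1 v) //= /D !eqxx /= big1 => [|y /negbTE -> //].
  rewrite big1 => [|x /negbTE xu]; first by rewrite !addr0.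
  by apply: big1 => y _; rewrite xu.
have symE (H : V -> V -> int) : \sum_x \sum_y (H x y + H y x) = 2 * \sum_x \sum_y H x y.
  under eq_bigr do rewrite big_split /=.
  by rewrite big_split /= [X in _ + X]exchange_big /=; ring.
have : \sum_x \sum_y (F x y + F y x) <= \sum_x \sum_y ((G x y - D x y) + (G y x - D y x)).
  apply: ler_sum => x _; apply: ler_sum => y _.
  rewrite /D; have := le_all x y; move: uv lt_uv.
  case: (x =P u) => xu; case: (y =P v) => yv; case: (y =P u) => yu; case: (x =P v) => xv;
    subst; rewrite ?eqxx //= => _; lia.
rewrite (symE F) (symE (fun x y => G x y - D x y)).
suff -> : \sum_x \sum_y (G x y - D x y) = \sum_x \sum_y G x y - 1 by lia.
under eq_bigr do rewrite sumrB.
by rewrite sumrB DE.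
Qed.

(** [S] is a set of rows and [W] a set of columns closed under alternating steps. Two weightings of
    the entries give [cut1] and [cut2], each with a slack of one from the zero at [(u, v)], and
    [deficient_cut_absurd] refutes them. *)
Lemma no_deficient_cut (V : finType) (A S W : pred V) (d : V -> int) (M : rel V)
    (s mu : int) (u v : V) :
  margins d M -> \sum_x (A x)%:Z = s -> 2 * s <= #|V|%:Z ->
  (forall x, s - 1 <= d x) -> s - 1 <= mu ->
  (forall x, A x -> mu <= d x) -> (forall x, ~~ A x -> d x <= mu) ->
  A u -> A v -> u != v -> ~~ M u v -> S u -> ~~ W v ->
  (forall x y, S x -> M x y -> ~~ (A x && A y) -> W y) ->
  (forall x y, W y -> ~~ S x -> x != y -> M x y) ->
  False.
Proof.
move=> marg sA sV d_ge mu_ge dA dB Au Av uv Muv Su Wv SW WS.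
have vu : v != u by rewrite eq_sym.
have Mxx : forall x, ~~ M x x by case: marg.
have SWb x y : [==> S x, M x y, ~~ (A x && A y) => W y].
  by apply/implyP => ?; apply/implyP => ?; apply/implyP; apply: SW.
have WSb x y : x != y -> [==> W y, ~~ S x => M x y].
  by move=> xy; apply/implyP => ?; apply/implyP => ?; apply: WS.
(* A vertex counts +1 as a row of [S] and -1 as a column of [W]; vertices that are
   both or neither cancel, so only the classes below enter the degree sums. *)
pose A1 x := (A x && S x && ~~ W x)%:Z.
pose A3 x := (A x && ~~ S x && W x)%:Z.
pose B1 x := (~~ A x && S x && ~~ W x)%:Z.
pose B3 x := (~~ A x && ~~ S x && W x)%:Z.
pose B0 x := (~~ A x && (S x == W x))%:Z.
pose A' x := (A x)%:Z.
pose del (x y : V) := (x == y)%:Z.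
have cut1 : \sum_x (A1 x - B3 x + B1 x) * d x <=
  (\sum_x A1 x) * s - (\sum_x B3 x) * (\sum_x B3 x + s - \sum_x A1 x + \sum_x B0 x)
  + (\sum_x A3 x) * (\sum_x B1 x) - \sum_x A1 x + \sum_x B3 x - 1.
  pose f x := (S x)%:Z + A3 x; pose g y := - (W y)%:Z.
  have -> : \sum_x (A1 x - B3 x + B1 x) * d x = \sum_x \sum_y (f x + g y) * (M x y)%:Z.
    rewrite (sum_row_col _ _ marg); apply: eq_bigr => x _; congr (_ * _).
    by rewrite /f /g /A1 /A3 /B1 /B3; case: (A x); case: (S x); case: (W x).
  pose G x y := A1 x * A' y - B3 x * (B3 y + A' y - A1 y + B0 y) + A3 x * B1 y
    - del x y * (A1 x - B3 x).
  have GE : \sum_x \sum_y G x y = (\sum_x A1 x) * s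
      - (\sum_x B3 x) * (\sum_x B3 x + s - \sum_x A1 x + \sum_x B0 x)
      + (\sum_x A3 x) * (\sum_x B1 x) - \sum_x A1 x + \sum_x B3 x.
    under eq_bigr do rewrite sumrB big_split sumrB /=.
    rewrite sumrB big_split sumrB /= sum_delta !sum_prod !sumrB.
    rewrite big_split sumrB big_split /= -/A' in sA * => /=; rewrite sA; ring.
  rewrite -GE; apply: (sum_pair_le uv) => [x y|].
  - rewrite /G /del /f /g /A1 /A3 /B1 /B3 /B0 /A'.
    case: (x =P y) => [<-|/eqP xy].
      by rewrite (negbTE (Mxx x)) eqxx; case: (A x); case: (S x); case: (W x).
    have yx : y != x by rewrite eq_sym.
    rewrite (negbTE yx).
    move: (SWb x y) (SWb y x) (WSb x y xy) (WSb y x yx).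
    by case: (A x); case: (A y); case: (S x); case: (S y); case: (W x); case: (W y);
      case: (M x y); case: (M y x).
  - rewrite /G /del /f /g /A1 /A3 /B1 /B3 /B0 /A'.
    move: (SWb v u) (WSb v u vu); rewrite (negbTE uv) (negbTE vu) Au Av Su (negbTE Wv) (negbTE Muv).
    by case: (S v); case: (W u); case: (M v u).
have cut2 : \sum_x A1 x * d x <= (\sum_x A1 x) * (s + \sum_x B3 x) - \sum_x A1 x - 1.
  (* The extra terms cancel the classes [B1] and [B3] as well, leaving the degree sum over [A1]
     alone. *)
  pose f x := (S x)%:Z + A3 x + B3 x; pose g y := - (W y)%:Z - B1 y.
  have -> : \sum_x A1 x * d x = \sum_x \sum_y (f x + g y) * (M x y)%:Z.
    rewrite (sum_row_col _ _ marg); apply: eq_bigr => x _; congr (_ * _).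
    by rewrite /f /g /A1 /A3 /B1 /B3; case: (A x); case: (S x); case: (W x).
  pose G x y := A1 x * (A' y + B3 y) - del x y * A1 x.
  have GE : \sum_x \sum_y G x y = (\sum_x A1 x) * (s + \sum_x B3 x) - \sum_x A1 x.
    under eq_bigr do rewrite sumrB /=.
    by rewrite sumrB /= sum_delta !sum_prod big_split /= -/A' sA.
  rewrite -GE; apply: (sum_pair_le uv) => [x y|].
  - rewrite /G /del /f /g /A1 /A3 /B1 /B3 /B0 /A'.
    case: (x =P y) => [<-|/eqP xy].
      by rewrite (negbTE (Mxx x)) eqxx; case: (A x); case: (S x); case: (W x).
    have yx : y != x by rewrite eq_sym.
    rewrite (negbTE yx).
    move: (SWb x y) (SWb y x) (WSb x y xy) (WSb y x yx).
    by case: (A x); case: (A y); case: (S x); case: (S y); case: (W x); case: (W y);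
      case: (M x y); case: (M y x).
  - rewrite /G /del /f /g /A1 /A3 /B1 /B3 /B0 /A'.
    move: (SWb v u) (WSb v u vu); rewrite (negbTE uv) (negbTE vu) Au Av Su (negbTE Wv) (negbTE Muv).
    by case: (S v); case: (W u); case: (M v u).
have splitE : \sum_x (A1 x - B3 x + B1 x) * d x =
    \sum_x A1 x * d x - \sum_x B3 x * d x + \sum_x B1 x * d x.
  by rewrite -sumrB -big_split; apply: eq_bigr => x _ /=; ring.
have ge0 (f : V -> bool) : 0 <= \sum_x (f x)%:Z by apply: sumr_ge0.
apply: (@deficient_cut_absurd (\sum_x A1 x) (\sum_x A3 x) (\sum_x B3 x) (\sum_x B1 x)
  (\sum_x B0 x) s mu (\sum_x A1 x * d x) (\sum_x B3 x * d x) (\sum_x B1 x * d x));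
  rewrite ?ge0 //.
- rewrite -sA -big_split; apply: ler_sum => x _ /=.
  by rewrite /A1 /A3; case: (A x); case: (S x); case: (W x).
- have sumE : s + \sum_x B3 x + \sum_x B1 x + \sum_x B0 x = #|V|%:Z.
    rewrite -sA -!big_split /= (eq_bigr (fun=> 1)) ?sumr_const ?natz // => x _.
    by rewrite /A' /B3 /B1 /B0; case: (A x); case: (S x); case: (W x).
  by move: sV sumE; lia.
- rewrite mulr_suml; apply: ler_sum => x _; rewrite /A1.
  by have [/dA|] := boolP (A x); case: (S x); case: (W x); rewrite /= ?mul0r ?mul1r.
- rewrite mulr_suml; apply: ler_sum => x _; rewrite /B3.
  by have [|/dB] := boolP (A x); case: (S x); case: (W x); rewrite /= ?mul0r ?mul1r.
- rewrite mulr_suml; apply: ler_sum => x _; rewrite /B1; have := d_ge x.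
  by case: (A x); case: (S x); case: (W x); rewrite /= ?mul0r ?mul1r.
- by move: cut1; rewrite splitE; lia.
- by move: cut2; lia.
Qed.

(** * Making a prescribed set complete *)

Lemma sum_indicator (V : finType) (b : bool) (c : V) :
  \sum_y (b && (y == c))%:Z = b%:Z.
Proof.
rewrite (bigD1 c) //= eqxx andbT big1 ?addr0 // => y /negbTE ->.
by rewrite andbF.
Qed.

Lemma sum_indicatorC (V : finType) (b : bool) (c : V) :
  \sum_y ((y == c) && b)%:Z = b%:Z.
Proof. by under eq_bigr do rewrite andbC; exact: sum_indicator. Qed.

Definition move_one (V : finType) (M : rel V) (x z c : V) : rel V :=
  fun a b => if b == c then (if a == x then false else (a == z) || M a b) else M a b.

Lemma move_oneE (V : finType) (M : rel V) (x z c a b : V) :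
  M x c -> ~~ M z c -> 
  (move_one M x z c a b)%:Z =
    (M a b)%:Z - ((a == x) && (b == c))%:Z + ((a == z) && (b == c))%:Z.
Proof.
move=> Mxc Mzc; have zx : z != x by apply: contraNneq Mzc => ->.
rewrite /move_one; case: (b =P c) => [->|_]; last by rewrite !andbF; lia.
rewrite !andbT; case: (a =P x) => [->|_].
  by rewrite Mxc eq_sym (negbTE zx).
by case: (a =P z) => [->|_]; rewrite ?(negbTE Mzc) //=; lia.
Qed.

Lemma move_one_row (V : finType) (M : rel V) (x z c a : V) :
  M x c -> ~~ M z c ->
  \sum_b (move_one M x z c a b)%:Z = \sum_b (M a b)%:Z - (a == x)%:Z + (a == z)%:Z.
Proof.
move=> Mxc Mzc; under eq_bigr do rewrite move_oneE //.
by rewrite big_split sumrB /= !sum_indicator.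
Qed.

Lemma move_one_col (V : finType) (M : rel V) (x z c b : V) :
  M x c -> ~~ M z c ->
  \sum_a (move_one M x z c a b)%:Z = \sum_a (M a b)%:Z.
Proof.
move=> Mxc Mzc; under eq_bigr do rewrite move_oneE //.
by rewrite big_split sumrB /= !sum_indicatorC; ring.
Qed.

(** A step from [x] to [z] means that some one of row [x], outside [A] x [A], can move within its
    column to row [z]; [z != b] keeps the diagonal zero. *)
Definition slide_step (V : finType) (A : pred V) (M : rel V) : rel V :=
  fun x z => [exists b, [&& M x b, ~~ (A x && A b), z != b & ~~ M z b]].

(** Performing the moves in order carries one unit of row sum from [x] to the end of the path. The
    first row only loses ones and the last only gains them, which is what the closing move of
    [margins_augment] requires. *)
Lemma slide_path (V : finType) (A : pred V) (p : seq V) (M : rel V) (x : V) :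
  (forall z, ~~ M z z) -> path (slide_step A M) x p -> uniq (x :: p) ->
  exists M' : rel V, [/\
    [/\ forall z, ~~ M' z z,
        forall a, \sum_b (M' a b)%:Z = \sum_b (M a b)%:Z - (a == x)%:Z + (a == last x p)%:Z
      & forall b, \sum_a (M' a b)%:Z = \sum_a (M a b)%:Z],
    forall a b, A a -> A b -> M a b -> M' a b,
    forall b, M (last x p) b -> M' (last x p) b,
    forall b, M' x b -> M x b &
    forall a b, a \notin x :: p -> M' a b = M a b].
Proof.
elim: p M x => [|z p IHp] M x Mirr /=.
  by move=> _ _; exists M; split=> //; split=> // a; lia.
case/andP=> /existsP[c /and4P[Mxc Axc zc Mzc]] path_p /andP[x_notin uniq_zp].
set M1 := move_one M x z c.
have xz : x != z by apply: contraNneq Mzc => <-.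
have M1_other a b : a != x -> a != z -> M1 a b = M a b.
  by move=> ax az; rewrite /M1 /move_one (negbTE ax) (negbTE az) /=; case: eqP => [->|].
have M1_x b : M1 x b -> M x b.
  by rewrite /M1 /move_one eqxx; case: ifP.
have M1_ge a b : a != x -> M a b -> M1 a b.
  by move=> ax Mab; rewrite /M1 /move_one (negbTE ax) Mab orbT if_same.
have M1irr a : ~~ M1 a a.
  rewrite /M1 /move_one; case: (a =P c) => [->|_]; last exact: Mirr.
  by case: eqP => // _; rewrite eq_sym (negbTE zc) /=; exact: Mirr.
(* The first move affects only rows [x] and [z]. As the path is simple, row [z] has kept its ones
   and all later rows are unchanged, so the remaining steps stay available. *)
have path1 : path (slide_step A M1) z p.
  have z_notin : z \notin p by case/andP: uniq_zp.
  have : z != x by rewrite eq_sym.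
  move: x_notin; rewrite inE negb_or => /andP[_].
  elim: p {1 3 4}z path_p z_notin {IHp uniq_zp} => //= y p IHp a /andP[step_ay path_yp].
  rewrite !inE !negb_or => /andP[zy zp] /andP[xy xp] ax.
  rewrite IHp //; last by rewrite eq_sym.
  rewrite andbT; case/existsP: step_ay => b /and4P[Mab Aab yb Myb].
  apply/existsP; exists b; rewrite M1_ge // Aab yb M1_other // 1?eq_sym //.
have [M' [[M'irr M'row M'col] M'A M'last M'z M'out]] := IHp M1 z M1irr path1 uniq_zp.
have x_neq_last : last z p != x by apply: contraNneq x_notin => <-; exact: mem_last.
exists M'; split.
- split=> // [a|b].
  + by rewrite M'row move_one_row // addrK.
  + by rewrite M'col move_one_col.
- move=> a b Aa Ab Mab; apply: M'A => //; rewrite /M1 /move_one Mab orbT.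
  by case: (b =P c) => // bc; case: (a =P x) => // ax; move: Axc; rewrite -ax -bc Aa Ab.
- by move=> b Mb; apply: M'last; apply: M1_ge.
- by move=> b; rewrite M'out //; apply: M1_x.
- move=> a b; rewrite inE negb_or => /andP[ax a_notin].
  by rewrite M'out // M1_other //; move: a_notin; rewrite inE negb_or => /andP[].
Qed.

(** Search the rows reachable from [u] by slides. Either column [v] has a movable one in such a row,
    and a closing move in column [v] fills [(u, v)], or the reached rows and columns form an
    impossible cut. *)
Lemma margins_augment (V : finType) (A : pred V) (d : V -> int) (M : rel V)
    (s mu : int) (u v : V) :
  margins d M -> \sum_x (A x)%:Z = s -> 2 * s <= #|V|%:Z ->
  (forall x, s - 1 <= d x) -> s - 1 <= mu ->
  (forall x, A x -> mu <= d x) -> (forall x, ~~ A x -> d x <= mu) ->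
  A u -> A v -> u != v -> ~~ M u v ->
  exists M' : rel V, [/\ margins d M', M' u v
    & forall a b, A a -> A b -> M a b -> M' a b].
Proof.
move=> marg sA sV d_ge mu_ge dA dB Au Av uv Muv.
pose S x := connect (slide_step A M) u x.
pose W b := [exists x, [&& S x, M x b & ~~ (A x && A b)]].
have [Wv|Wv] := boolP (W v); last first.
  exfalso; apply: (@no_deficient_cut V A S W d M s mu u v) => //.
  - exact: connect0.
  - by move=> x y Sx Mxy Axy; apply/existsP; exists x; rewrite Sx Mxy Axy.
  (* A zero at [(x, y)] would let the one at [(z, y)] slide to row [x], making [x] reachable. *)
  - move=> x y /existsP[z /and3P[Sz Mzy Azy]] Sx xy; apply: contraNT Sx => Mxy.
    apply: connect_trans Sz _; apply: connect1.
    by apply/existsP; exists y; rewrite Mzy Azy xy Mxy.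
case/existsP: Wv => x /and3P[/connectP[p0 path_p0 xE] Mxv].
rewrite Av andbT => Ax; case: marg => Mirr Mrow Mcol.
case/shortenP: path_p0 xE => p path_p uniq_p _ xE.
have [M' [[M'irr M'row M'col] M'A M'last M'u M'out]] := slide_path Mirr path_p uniq_p.
rewrite -xE in M'row M'last.
have M'xv := M'last _ Mxv.
have M'uv : ~~ M' u v by apply: contraNN Muv; exact: M'u.
have ux : u != x by apply: contraNneq Ax => <-.
(* Sliding took a unit from row [u] and gave it to row [x]; this move returns it. It destroys no one
   in [A] x [A], since [x] is outside [A]. *)
exists (move_one M' x u v); split.
- split=> [a|a|b].
  + rewrite /move_one; case: (a =P v) => [->|_]; last exact: M'irr.
    by case: ifP => // _; rewrite eq_sym (negbTE uv) /=; exact: M'irr.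
  + by rewrite move_one_row // M'row Mrow addrK addrNK.
  + by rewrite move_one_col // M'col.
- by rewrite /move_one !eqxx (negbTE ux).
- move=> a b Aa Ab /(M'A a b Aa Ab) Mab; rewrite /move_one Mab orbT.
  by case: (b =P v) => // _; case: (a =P x) => // ax; move: Ax; rewrite -ax Aa.
Qed.

Lemma margins_full (V : finType) (A : pred V) (d : V -> int) (M : rel V) (s mu : int) :
  margins d M -> \sum_x (A x)%:Z = s -> 2 * s <= #|V|%:Z ->
  (forall x, s - 1 <= d x) -> s - 1 <= mu ->
  (forall x, A x -> mu <= d x) -> (forall x, ~~ A x -> d x <= mu) ->
  exists M' : rel V, margins d M' /\ forall a b, A a -> A b -> a != b -> M' a b.
Proof.
move=> + sA sV d_ge mu_ge dA dB.
pose miss (N : rel V) :=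
  [set p : V * V | [&& A p.1, A p.2, p.1 != p.2 & ~~ N p.1 p.2]].
have [k] := ubnP #|miss M|; elim: k M => // k IHk M leMk marg.
have [missM0|[[u v]]] := set_0Vmem (miss M).
  exists M; split=> // a b Aa Ab ab; apply/negPn/negP => Mab.
  by have := in_set0 (a, b); rewrite -missM0 inE /= Aa Ab ab Mab.
rewrite inE /= => /and4P[Au Av uv Muv].
have [M' [marg' M'uv M'A]] :=
  margins_augment marg sA sV d_ge mu_ge dA dB Au Av uv Muv.
apply: (IHk M') => //; rewrite -ltnS; apply: leq_trans leMk; rewrite ltnS.
apply: proper_card; apply/properP; split.
  apply/subsetP => -[a b]; rewrite !inE /= => /and4P[Aa Ab -> Mab].
  by rewrite Aa Ab; apply: contraNN Mab; exact: M'A.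
by exists (u, v); rewrite !inE /= Au Av uv ?Muv // M'uv.
Qed.

(** * From half-integral to integral realizations *)

(** The handshake argument: each off-diagonal term equals its transpose, and ranks select one term
    of each pair. *)
Lemma sym_sum_even (V : finType) (f : V -> V -> int) :
  (forall x y, f x y = f y x) -> (forall x, f x x = 0) ->
  exists k, \sum_x \sum_y f x y = 2 * k.
Proof.
move=> fC f0; pose r (x : V) : nat := enum_rank x.
exists (\sum_x \sum_y (r x < r y)%N%:Z * f x y).
have -> : \sum_x \sum_y f x y =
    \sum_x \sum_y ((r x < r y)%N%:Z * f x y + (r y < r x)%N%:Z * f y x).
  apply: eq_bigr => x _; apply: eq_bigr => y _; rewrite (fC y x).
  case: ltngtP => [_|_|rE]; rewrite ?mul1r ?mul0r ?addr0 ?add0r //.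
  suff -> : x = y by rewrite f0.
  by apply: enum_rank_inj; apply: ord_inj.
under eq_bigr do rewrite big_split /=.
by rewrite big_split /= [X in _ + X]exchange_big /=; ring.
Qed.

(** A signed subgraph of [O], with [0] marking the pairs left out; its row sums are its boundary. *)
Definition signing (V : finType) (O : rel V) (e : V -> V -> int) : Prop :=
  [/\ forall x y, e x y = e y x, forall x y, -1 <= e x y <= 1
    & forall x y, e x y != 0 -> O x y].

Lemma signing_abs (e : int) : -1 <= e <= 1 -> (e != 0)%:Z = e + 2 * (e == -1)%:Z.
Proof.
move=> eb; have [->|[->|->]] // : e = -1 \/ e = 0 \/ e = 1 by lia.
Qed.

(** In particular the degree in the support and the boundary have the same parity at each vertex. *)
Lemma signing_degree (V : finType) (e : V -> V -> int) (x : V) :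
  (forall x y, -1 <= e x y <= 1) ->
  \sum_y (e x y != 0)%:Z = \sum_y e x y + 2 * \sum_y (e x y == -1)%:Z.
Proof.
move=> eb; rewrite mulr_sumr -big_split; apply: eq_bigr => y _ /=.
exact: signing_abs.
Qed.

Definition even_graph (V : finType) (O : rel V) : Prop :=
  [/\ forall x y, O x y = O y x, forall x, ~~ O x x
    & forall x, exists k, \sum_y (O x y)%:Z = 2 * k].

(* A trail from [b] to [x] with alternating signs has boundary [b + tau x]; it
   can be prolonged unless it is back at [b]. *)
Lemma trail_close (V : finType) (O : rel V) (b x : V) (tau : int) (e : V -> V -> int) :
  even_graph O -> signing O e -> (exists p, exists q, e p q != 0) ->
  tau = 1 \/ tau = -1 ->
  (forall z, \sum_y e z y = (z == b)%:Z + tau * (z == x)%:Z) ->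
  exists e' c, [/\ signing O e', exists p, exists q, e' p q != 0, c = 0 \/ c = 2
    & forall z, \sum_y e' z y = c * (z == b)%:Z].
Proof.
move=> [OC Oirr Oeven].
pose free (f : V -> V -> int) := [set p : V * V | O p.1 p.2 && (f p.1 p.2 == 0)].
have [k] := ubnP #|free e|.
elim: k e x tau => // k IHk e x tau le_k [eC eb eO] e_n0 tau1 bdry.
have [xb|xb] := eqVneq x b.
  exists e, (1 + tau); split=> //; first by case: tau1 => ->; [right|left].
  by move=> z; rewrite bdry xb mulrDl mul1r.
(* If every edge at [x] were used, the even degree of [x] in [O] would have the parity of the
   boundary there, which is [tau], hence odd. *)
have [z /andP[Oxz exz]] : exists z, O x z && (e x z == 0).
  have [/existsP //|] := boolP [exists z, O x z && (e x z == 0)].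
  rewrite negb_exists => /forallP no_free; exfalso.
  have OE : \sum_y (O x y)%:Z = \sum_y (e x y != 0)%:Z.
    apply: eq_bigr => y _; congr (Posz (nat_of_bool _)); apply/idP/idP; last exact: eO.
    by move=> Oxy; move: (no_free y); rewrite Oxy.
  move: OE; rewrite signing_degree // bdry eqxx (negbTE xb).
  have [m ->] := Oeven x; clear -tau1.
  by move: (\sum_y _) => q; case: tau1 => ->; lia.
have xz : x != z by apply: contraTneq Oxz => <-.
(* The new edge has sign [- tau]: it cancels the boundary at [x] and leaves [- tau] at [z]. *)
pose e' p q := e p q - tau * ((p == x) && (q == z))%:Z - tau * ((p == z) && (q == x))%:Z.
have e'E p q : e' p q = if ((p == x) && (q == z)) || ((p == z) && (q == x)) then - tau else e p q.
  rewrite /e'; case: (p =P x) => [->|_] /=; last first.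
    by case: (p =P z) => [->|_] /=; case: (q =P x) => [->|_] /=;
      rewrite ?mulr0 ?subr0 // mulr1 eC (eqP exz) sub0r.
  rewrite (negbTE xz) /=; case: (q =P z) => [->|_]; rewrite ?mulr0 ?subr0 //.
  by rewrite mulr1 (eqP exz) sub0r.
have Ozx : O z x by rewrite OC.
apply: (IHk e' z (- tau)).
- rewrite -ltnS; apply: leq_trans le_k; rewrite ltnS; apply: proper_card.
  apply/properP; split.
    apply/subsetP => -[p q]; rewrite !inE /= e'E => /andP[-> /=].
    by case: ifP => // _; case: tau1 => ->.
  exists (x, z); rewrite !inE /= Oxz ?exz // e'E !eqxx /=.
  by case: tau1 => ->.
- split.
  + move=> p q; rewrite !e'E eC; congr (if _ then _ else _).
    by rewrite orbC; congr (_ || _); rewrite andbC.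
  + by move=> p q; rewrite e'E; case: ifP => // _; case: tau1 => ->.
  + move=> p q; rewrite e'E; case: ifP => [|_]; last exact: eO.
    by case/orP => /andP[/eqP-> /eqP->].
- exists x, z; rewrite e'E !eqxx /=; by case: tau1 => ->.
- by case: tau1 => ->; [right|left]; rewrite ?opprK.
- move=> p; rewrite /e' !sumrB -!mulr_sumr !sum_indicator bdry; ring.
Qed.

(** Start with the edge [bz] of sign [1] and close the trail. Even closed trails have [c = 0]; odd
    ones have an unbalanced boundary [c = 2] at [b]. *)
Lemma trail_from (V : finType) (O : rel V) (b z : V) :
  even_graph O -> O b z ->
  exists e c, [/\ signing O e, exists p, exists q, e p q != 0, c = 0 \/ c = 2
    & forall x, \sum_y e x y = c * (x == b)%:Z].
Proof.
move=> evO Obz; have [OC Oirr _] := evO.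
have bz : b != z by apply: contraTneq Obz => <-.
pose e p q : int := (((p == b) && (q == z)) || ((p == z) && (q == b)))%:Z.
have eE p q : e p q = ((p == b) && (q == z))%:Z + ((p == z) && (q == b))%:Z.
  rewrite /e; case: (p =P b) => [->|_] /=; first by rewrite (negbTE bz) orbF addr0.
  by rewrite add0r.
apply: (@trail_close V O b z 1 e) => //; last 2 first.
- by left.
- by move=> x; under eq_bigr do rewrite eE; rewrite big_split /= !sum_indicator mul1r.
- split.
  + by move=> p q; rewrite !eE addrC andbC; congr (_ + _); rewrite andbC.
  + by move=> p q; rewrite /e; case: (_ || _).
  + move=> p q; rewrite /e; case: (boolP (_ || _)) => // /orP[] /andP[/eqP-> /eqP->] _ //.
    by rewrite OC.
- by exists b, z; rewrite /e !eqxx.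
Qed.

(* [y p q] is twice the weight of the pair [pq]. *)
Definition half_graph (V : finType) (A : pred V) (d : V -> int) (y : V -> V -> int) : Prop :=
  [/\ forall p q, y p q = y q p, forall p, y p p = 0, forall p q, 0 <= y p q <= 2,
      forall p, \sum_q y p q = 2 * d p
    & forall p q, A p -> A q -> p != q -> y p q = 2].

Definition halves (V : finType) (y : V -> V -> int) : rel V := fun p q => y p q == 1.

Definition num_halves (V : finType) (y : V -> V -> int) : nat :=
  #|[set p : V * V | halves y p.1 p.2]|.

(** The general rounding move: [h] creates no half and destroys at least one. It may also change
    integral pairs, as is needed when two odd trails are joined. *)
Lemma half_graph_shift (V : finType) (A : pred V) (d : V -> int) (y h : V -> V -> int) :
  half_graph A d y ->
  (forall p q, h p q = h q p) -> (forall p, h p p = 0) ->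
  (forall p, \sum_q h p q = 0) -> (forall p q, 0 <= y p q + h p q <= 2) ->
  (forall p q, A p -> A q -> h p q = 0) ->
  (forall p q, y p q + h p q = 1 -> y p q = 1) ->
  (exists p, exists q, y p q = 1 /\ h p q != 0) ->
  exists y', half_graph A d y' /\ (num_halves y' < num_halves y)%N.
Proof.
move=> [yC y0 yb ysum yA] hC h0 hsum hb hA h1 [p [q [ypq hpq]]].
exists (fun p q => y p q + h p q); split; first split=> //.
- by move=> a b; rewrite yC hC.
- by move=> a; rewrite y0 h0.
- by move=> a; rewrite big_split /= ysum hsum addr0.
- by move=> a b Aa Ab ab; rewrite yA // hA.
apply: proper_card; apply/properP; split.
  by apply/subsetP => -[a b]; rewrite !inE /halves /= => /eqP/h1/eqP.
exists (p, q); rewrite !inE /halves /= ypq ?eqxx // -subr_eq0 addrC addKr //.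
Qed.

Lemma signing_sub (V : finType) (O O' : rel V) (e : V -> V -> int) :
  (forall p q, O' p q -> O p q) -> signing O' e -> signing O e.
Proof. by move=> sub [eC eb eO]; split=> // p q /eO/sub. Qed.

(** Adding a balanced signing turns each [1] on its support into [0] or [2]. *)
Lemma half_graph_balanced (V : finType) (A : pred V) (d : V -> int) (y e : V -> V -> int) :
  half_graph A d y -> signing (halves y) e -> (exists p, exists q, e p q != 0) ->
  (forall p, \sum_q e p q = 0) ->
  exists y', half_graph A d y' /\ (num_halves y' < num_halves y)%N.
Proof.
move=> hy [eC eb eO] [p [q epq]] esum; have [yC y0 yb ysum yA] := hy.
have e_y a b : e a b = 0 \/ y a b = 1.
  by have [->|/eO/eqP] := eqVneq (e a b) 0; [left|right].
have e0 a : e a a = 0 by case: (e_y a a) => //; rewrite y0.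
apply: (half_graph_shift hy eC e0 esum).
- by move=> a b; have := eb a b; have := yb a b; case: (e_y a b) => ->; clear; lia.
- move=> a b Aa Ab; have [<-|ab] := eqVneq a b; first exact: e0.
  by case: (e_y a b) => //; rewrite yA.
- by move=> a b; case: (e_y a b) => [->|//]; rewrite addr0.
- by exists p, q; split=> //; case: (e_y p q) => // epq0; rewrite epq0 in epq.
Qed.

Lemma signing_disjoint_sub (V : finType) (O O1 O2 : rel V) (e1 e2 : V -> V -> int) :
  signing O1 e1 -> signing O2 e2 ->
  (forall p q, O1 p q -> O p q) -> (forall p q, O2 p q -> O p q) ->
  (forall p q, O1 p q -> ~~ O2 p q) -> (exists p, exists q, e1 p q != 0) ->
  signing O (fun p q => e1 p q - e2 p q) /\ exists p, exists q, e1 p q - e2 p q != 0.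
Proof.
move=> [e1C e1b e1O] [e2C e2b e2O] sub1 sub2 disj [a [b eab]].
have e20 p q : e1 p q != 0 -> e2 p q = 0.
  by move=> /e1O/disj; apply: contraNeq => /e2O.
split; last by exists a, b; rewrite e20 // subr0.
split.
- by move=> p q; rewrite e1C e2C.
- move=> p q; have := e1b p q; have := e2b p q.
  by have [->|/e20->] := eqVneq (e1 p q) 0; clear; lia.
- move=> p q; have [->|e1pq _] := eqVneq (e1 p q) 0; last exact/sub1/e1O.
  by rewrite sub0r oppr_eq0 => /e2O/sub2.
Qed.

(** Row sums of [y] are even, and so is the contribution of the entries equal to [2]. *)
Lemma halves_even (V : finType) (A : pred V) (d : V -> int) (y : V -> V -> int) :
  half_graph A d y -> even_graph (halves y).
Proof.
move=> [yC y0 yb ysum _]; split.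
- by move=> p q; rewrite /halves yC.
- by move=> p; rewrite /halves y0.
move=> p; exists (d p - \sum_q (y p q == 2)%:Z).
rewrite mulrBr -ysum mulr_sumr -sumrB; apply: eq_bigr => q _.
rewrite /halves; have := yb p q; move: (y p q) => n nb.
have [->|[->|->]] // : n = 0 \/ n = 1 \/ n = 2 by clear -nb; lia.
Qed.

Lemma support_even (V : finType) (O : rel V) (e : V -> V -> int) (c : int) (b : V) :
  even_graph O -> signing O e -> c = 0 \/ c = 2 ->
  (forall x, \sum_y e x y = c * (x == b)%:Z) -> even_graph (fun x y => e x y != 0).
Proof.
move=> [OC Oirr _] [eC eb eO] c02 bdry; split.
- by move=> x y; rewrite eC.
- by move=> x; apply: contraNN (Oirr x) => /eO.
move=> x; rewrite signing_degree // bdry.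
case: c02 => ->; first by rewrite mul0r add0r; eexists.
by rewrite -mulrDr; eexists.
Qed.

Lemma even_graph_diff (V : finType) (O E : rel V) :
  even_graph O -> even_graph E -> (forall x y, E x y -> O x y) ->
  even_graph (fun x y => O x y && ~~ E x y).
Proof.
move=> [OC Oirr Oev] [EC Eirr Eev] sub; split.
- by move=> x y; rewrite OC EC.
- by move=> x; rewrite (negbTE (Oirr x)).
move=> x; have [k kE] := Oev x; have [l lE] := Eev x; exists (k - l).
rewrite mulrBr -kE -lE -sumrB; apply: eq_bigr => y _.
by have := sub x y; case: (E x y) => [->|] //=; rewrite andbT subr0.
Qed.

(** An even closed trail of halves is rounded directly. Otherwise parity yields a second odd trail,
    disjoint from the first; the two are combined at a common vertex, along a half edge, or through
    an integral pair outside [A] x [A]. *)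
Lemma half_graph_reduce (V : finType) (A : pred V) (d : V -> int) (y : V -> V -> int)
    (k : int) (p q : V) :
  half_graph A d y -> \sum_x d x = 2 * k -> y p q = 1 ->
  exists y', half_graph A d y' /\ (num_halves y' < num_halves y)%N.
Proof.
move=> hy dk ypq; have [yC y0 yb ysum yA] := hy.
set O := halves y; have evO : even_graph O := halves_even hy.
have [OC Oirr Oev] := evO.
have outA x z : O x z -> exists2 c, ~~ A c & exists c', O c c'.
  move=> Oxz; have [Ax|?] := boolP (A x); last by exists x => //; exists z.
  have [Az|?] := boolP (A z); last by exists z => //; exists x; rewrite OC.
  have xz : x != z by apply: contraTneq Oxz => <-.
  by move: Oxz; rewrite /O /halves yA.
have Opq : O p q by rewrite /O /halves ypq.
have [b nAb [b' Obb']] := outA _ _ Opq.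
have [e1 [c1 [sg1 n01 c102 bd1]]] := trail_from evO Obb'.
have balanced e : signing O e -> (exists x, exists z, e x z != 0) ->
    (forall x, \sum_z e x z = 0) ->
    exists y', half_graph A d y' /\ (num_halves y' < num_halves y)%N.
  by move=> *; apply: (half_graph_balanced hy); eassumption.
case: (c102) => c1E; first by apply: (balanced e1) => // x; rewrite bd1 c1E mul0r.
pose E1 : rel V := fun x z => e1 x z != 0.
have evE : even_graph E1 := support_even evO sg1 c102 bd1.
have [_ e1b E1O] := sg1.
pose O1 : rel V := fun x z => O x z && ~~ E1 x z.
have evO1 : even_graph O1 := even_graph_diff evO evE E1O.
have O1O x z : O1 x z -> O x z by case/andP.
have disj x z : E1 x z -> ~~ O1 x z by rewrite /O1 => ->; rewrite andbF.
have sg1E : signing E1 e1 by case: sg1.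
(* If the odd trail used all halves, counting ordered pairs would give a multiple of 4 from [y],
   whose total is [4k], but 2 modulo 4 from the trail. *)
have [c0 [c0' O1c0]] : exists x, exists z, O1 x z.
  have [/existsP[x /existsP[z O1xz]]|none] := boolP [exists x, exists z, O1 x z].
    by exists x, z.
  exfalso; have OE x z : O x z = E1 x z.
    apply/idP/idP => [Oxz|]; last exact: E1O.
    apply: contraNT none => E1xz; apply/existsP; exists x; apply/existsP; exists z.
    by rewrite /O1 Oxz.
  have [k1 k1E] : exists k1, \sum_x \sum_z (y x z == 2)%:Z = 2 * k1.
    by apply: sym_sum_even => [x z|x]; rewrite ?y0 // yC.
  have [k2 k2E] : exists k2, \sum_x \sum_z (e1 x z == -1)%:Z = 2 * k2.
    case: sg1 => e1C _ _; apply: sym_sum_even => [x z|x]; first by rewrite e1C.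
    by have /negbTE := Oirr x; rewrite OE /E1 => /negbFE/eqP->.
  have sO : \sum_x \sum_z (O x z)%:Z = 2 * (2 * k) - 2 * (2 * k1).
    rewrite -dk -k1E !mulr_sumr -sumrB; apply: eq_bigr => x _.
    rewrite -ysum mulr_sumr -sumrB; apply: eq_bigr => z _.
    rewrite /O /halves; have := yb x z; move: (y x z) => n nb.
    by have [->|[->|->]] // : n = 0 \/ n = 1 \/ n = 2 by clear -nb; lia.
  have sE : \sum_x \sum_z (E1 x z)%:Z = 2 + 2 * (2 * k2).
    rewrite -k2E mulr_sumr.
    rewrite -[X in X + _](_ : \sum_x 2 * (x == b)%:Z = 2).
      rewrite -big_split; apply: eq_bigr => x _ /=.
      by rewrite (signing_degree x e1b) bd1 c1E.
    rewrite -mulr_sumr (eq_bigr (fun x => ((x == b) && true)%:Z)) ?sum_indicatorC //.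
    by move=> x _; rewrite andbT.
  have : \sum_x \sum_z (O x z)%:Z = \sum_x \sum_z (E1 x z)%:Z.
    by apply: eq_bigr => x _; apply: eq_bigr => z _; rewrite OE.
  by rewrite sO sE; clear; lia.
have [c nAc [c' O1cc']] : exists2 c, ~~ A c & exists c', O1 c c'.
  have [A0|?] := boolP (A c0); last by exists c0 => //; exists c0'.
  exists c0'; last by exists c0; case: evO1 => ->.
  apply/negP => A0'; have /O1O := O1c0.
  have [<-|cc] := eqVneq c0 c0'; first by rewrite (negbTE (Oirr _)).
  by rewrite /O /halves yA.
have odd_trail (O' : rel V) x z : even_graph O' -> O' x z ->
    (forall x z, O' x z -> O x z) ->
    (exists y', half_graph A d y' /\ (num_halves y' < num_halves y)%N) \/
    exists e, [/\ signing O' e, exists x, exists z, e x z != 0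
      & forall a, \sum_z e a z = 2 * (a == x)%:Z].
  move=> evO' O'xz sub; have [e [c2 [sg n0 [->|->] bd]]] := trail_from evO' O'xz.
    by left; apply: (balanced e (signing_sub sub sg) n0) => a; rewrite bd mul0r.
  by right; exists e.
have [//|[e2 [sg2 n02 bd2]]] := odd_trail O1 c c' evO1 O1cc' O1O.
(* When the first trail meets [c], its support contains another trail based at [c]; if odd, it has
   the same boundary as [e2], so their difference is balanced. *)
have [/existsP[z E1cz]|E1c] := boolP [exists z, E1 c z].
  have [//|[e3 [sg3 n03 bd3]]] := odd_trail E1 c z evE E1cz E1O.
  have [sg n0] := signing_disjoint_sub sg3 sg2 E1O O1O disj n03.
  by apply: (balanced _ sg n0) => x; rewrite sumrB bd3 bd2 subrr.
(* When [bc] is a half, it lies in [O1] because [E1] misses [c]; an odd trail of [O1] based at [b]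
   then balances [e1]. *)
have [Obc|Obc] := boolP (O b c).
  have O1bc : O1 b c.
    rewrite /O1 Obc; apply: contraNN E1c => E1bc; apply/existsP; exists b.
    by case: evE => ->.
  have [//|[e4 [sg4 n04 bd4]]] := odd_trail O1 b c evO1 O1bc O1O.
  have [sg n0] := signing_disjoint_sub sg1E sg4 E1O O1O disj n01.
  by apply: (balanced _ sg n0) => x; rewrite sumrB bd1 bd4 c1E subrr.
have [e2C e2b e2O] := sg2; have [e1C _ _] := sg1.
have bc : b != c.
  apply: contraNneq E1c => bc; rewrite -bc.
  have [|none] := boolP [exists z, E1 b z]; first by [].
  move: none; rewrite negb_exists => /forallP none.
  have : \sum_z e1 b z = 0 by apply: big1 => z _; apply/eqP/negPn; exact: none.
  by rewrite bd1 c1E eqxx.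
(* Two odd closed trails, based at [b] and [c], have boundaries [2b] and [2c],
   which the integral pair [bc] compensates. *)
pose D x z : int := ((x == b) && (z == c))%:Z + ((x == c) && (z == b))%:Z.
(* As [bc] is not a half, it has weight [0] or [2]; this sign makes the change [2 * s] switch
   between the two. *)
pose s : int := if y b c == 0 then 1 else -1.
have O0 x z : ~~ O x z -> e1 x z = 0 /\ e2 x z = 0.
  move=> Oxz; split; apply/eqP; apply: contraNT Oxz; first exact: E1O.
  by move=> /e2O/O1O.
(* Three kinds of pairs: the pair [bc] itself, pairs that do not change, and halves met by at most
   one trail. *)
have D0 x z : [\/ [/\ D x z = 1, e1 x z = 0, e2 x z = 0, y x z = y b c & ~~ (A x && A z)],
    [/\ D x z = 0, e1 x z = 0 & e2 x z = 0]
    | [/\ D x z = 0, y x z = 1 & e1 x z = 0 \/ e2 x z = 0]].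
  have [/andP[/eqP-> /eqP->]|n1] := boolP ((x == b) && (z == c)).
    by apply: Or31; have [] := O0 b c Obc; rewrite /D !eqxx (negbTE bc) (negbTE nAb).
  have [/andP[/eqP-> /eqP->]|n2] := boolP ((x == c) && (z == b)).
    have Ocb : ~~ O c b by rewrite OC.
    apply: Or31; have [] := O0 c b Ocb.
    by rewrite /D !eqxx (negbTE nAb) andbF (yC c) andbC (negbTE bc).
  have Dxz : D x z = 0 by rewrite /D (negbTE n1) (negbTE n2).
  have [Oxz|/O0[]] := boolP (O x z); last by move=> ? ?; apply: Or32.
  apply: Or33; split=> //; first exact/eqP.
  have [->|e1xz] := eqVneq (e1 x z) 0; first by left.
  by right; apply/eqP; apply: contraNT (disj _ _ e1xz) => /e2O.
have s1 : s = 1 /\ y b c = 0 \/ s = -1 /\ y b c = 2.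
  rewrite /s; have [->|yn0] := eqVneq (y b c) 0; [by left|right; split=> //].
  by move: (yb b c) yn0 Obc; rewrite /O /halves; clear; lia.
apply: (half_graph_shift (h := fun x z => s * (2 * D x z - e1 x z - e2 x z)) hy).
- move=> x z; rewrite e1C e2C /D; congr (s * (_ * _ - _ - _)).
  by rewrite addrC andbC; congr (_ + _); rewrite andbC.
- move=> x; have [-> ->] := O0 x x (Oirr x).
  by rewrite /D; case: (x =P b) => [->|_]; rewrite ?(negbTE bc) ?andbF ?subr0 ?mulr0.
- move=> x; rewrite -mulr_sumr !sumrB bd1 bd2 c1E -mulr_sumr.
  by rewrite big_split /= !sum_indicator; ring.
- move=> x z; have := yb x z; have := e1b x z; have := e2b x z.
  case: (D0 x z) => [[-> -> -> -> _]|[-> -> ->]|[-> -> [->|->]]]; clear -s1.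
  + by case: s1 => [[-> ->]|[-> ->]].
  + by case: s1 => [[-> _]|[-> _]]; lia.
  + by case: s1 => [[-> _]|[-> _]]; lia.
  + by case: s1 => [[-> _]|[-> _]]; lia.
- move=> x z Ax Az; case: (D0 x z) => [[_ _ _ _]|[-> -> ->]|[_ yxz _]].
  + by rewrite Ax Az.
  + by rewrite !mulr0.
  + have [xz|xz] := eqVneq x z; first by move: yxz; rewrite xz y0.
    by move: yxz; rewrite yA.
- move=> x z; case: (D0 x z) => [[-> -> -> -> _]|[-> -> ->]|[_ -> _ //]].
  + by case: s1 => [[-> ->]|[-> ->]].
  + by rewrite !mulr0 addr0.
- have [x [z e1xz]] := n01; exists x, z.
  case: (D0 x z) => [[_ e1xz0 _ _ _]|[_ e1xz0 _]|[-> yxz [e1xz0|->]]].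
  + by rewrite e1xz0 in e1xz.
  + by rewrite e1xz0 in e1xz.
  + by rewrite e1xz0 in e1xz.
  + split=> //; rewrite mulr0 sub0r subr0 mulrN oppr_eq0 mulf_neq0 //.
    by case: s1 => [[-> _]|[-> _]].
Qed.

(** The sum of [M] and its transpose is a half-integral realization; removing its halves by
    [half_graph_reduce] leaves weights [0] and [2], hence a graph. *)
Lemma margins_symmetric (V : finType) (A : pred V) (d : V -> int) (k : int) (M : rel V) :
  margins d M -> (forall a b, A a -> A b -> a != b -> M a b) -> \sum_x d x = 2 * k ->
  exists e : rel V, [/\ forall x y, e x y = e y x, forall x, ~~ e x x,
    forall x, \sum_y (e x y)%:Z = d x & forall a b, A a -> A b -> a != b -> e a b].
Proof.
move=> [Mirr Mrow Mcol] MA dk.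
suff [y [hy no_half]] : exists y, half_graph A d y /\ forall p q, y p q != 1.
  have [yC y0 yb ysum yA] := hy; exists (fun p q => y p q == 2); split.
  - by move=> p q; rewrite yC.
  - by move=> p; rewrite y0.
  - move=> p; apply: (mulfI (_ : 2 != 0 :> int)) => //; rewrite -ysum mulr_sumr.
    apply: eq_bigr => q _; have := yb p q; have := no_half p q.
    move: (y p q) => n n1 nb; have [->|->] // : n = 0 \/ n = 2 by clear -n1 nb; lia.
  - by move=> a b Aa Ab ab; rewrite yA.
have : half_graph A d (fun p q => (M p q)%:Z + (M q p)%:Z).
  split.
  - by move=> p q; rewrite addrC.
  - by move=> p; rewrite (negbTE (Mirr p)).
  - by move=> p q; case: (M p q); case: (M q p).
  - by move=> p; rewrite big_split /= Mrow Mcol; ring.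
  - by move=> a b Aa Ab ab; rewrite !MA // eq_sym.
move: (fun p q => _) => y; have [n] := ubnP (num_halves y).
elim: n y => // n IHn y le_n hy.
have [/existsP[p /existsP[q /eqP ypq]]|none] := boolP [exists p, exists q, y p q == 1].
  have [y' [hy' lt_y']] := half_graph_reduce hy dk ypq.
  by apply: (IHn y') hy'; apply: leq_trans lt_y' _; rewrite -ltnS.
exists y; split=> // p q; apply: contraNN none => ypq.
by apply/existsP; exists p; apply/existsP; exists q.
Qed.

(** * Degree sequences, cliques and stars *)

Lemma sum_deg (V : finType) (e : rel V) (x : V) : \sum_y (e x y)%:Z = (deg e x)%:Z.
Proof.
rewrite /deg -sum1_card -natz natr_sum [RHS]big_mkcond /=.
by apply: eq_bigr => y _; rewrite inE; case: (e x y).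
Qed.

Lemma sorted_geq_nth (pi : seq nat) (i j : nat) :
  sorted geq pi -> (i <= j < size pi)%N -> (nth 0 pi j <= nth 0 pi i)%N.
Proof.
move=> pi_sorted /andP[ij jN].
have tr : transitive geq by move=> a b c /= ab bc; exact: leq_trans bc ab.
have rf : reflexive geq by move=> a /=.
by apply: (sorted_leq_nth tr rf 0 pi_sorted) => //; rewrite inE //; exact: leq_ltn_trans jN.
Qed.

Lemma realizes_clique (N s : nat) (e : rel 'I_N) (pi : seq nat) :
  realizes e pi -> sorted geq pi -> (2 * s <= N)%N -> (0 < s)%N ->
  (forall i : 'I_N, s.-1 <= nth 0 pi i)%N ->
  exists2 e' : rel 'I_N, realizes e' pi
    & forall i j : 'I_N, (i < s)%N -> (j < s)%N -> i != j -> e' i j.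
Proof.
move=> [sz [[eC eirr] edeg]] srt sN s0 dmin.
pose d (i : 'I_N) : int := (nth 0 pi i)%N.
pose A : pred 'I_N := fun i => (i < s)%N.
have s1N : (s.-1 < N)%N by lia.
have marg : margins d e.
  split=> // x; first by rewrite sum_deg edeg.
  by under eq_bigr do rewrite eC; rewrite sum_deg edeg.
have sumA : \sum_i (A i)%:Z = s%:Z.
  have -> : s%:Z = (\sum_(i < s) 1)%N%:Z by rewrite sum1_card card_ord.
  rewrite (big_ord_widen N (fun=> 1%N)); last by lia.
  rewrite -natz natr_sum [RHS]big_mkcond /=.
  by apply: eq_bigr => i _; rewrite /A; case: (_ < _)%N.
have [k kE] : exists k, \sum_x d x = 2 * k.
  have [k kE] : exists k, \sum_x \sum_y (e x y)%:Z = 2 * k.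
    by apply: sym_sum_even => [x y|x]; rewrite ?(negbTE (eirr x)) // eC.
  by exists k; rewrite -kE; apply: eq_bigr => x _; rewrite sum_deg edeg.
have [M [margM MA]] : exists M : rel 'I_N, margins d M /\
    forall a b, A a -> A b -> a != b -> M a b.
  (* The separating value is the [s]-th largest degree, at index [s.-1]. *)
  apply: (@margins_full _ A d e s (nth 0 pi s.-1)%N) => //.
  - by rewrite card_ord; lia.
  - by move=> x; have := dmin x; rewrite /d; lia.
  - by have := dmin (Ordinal s1N); rewrite /=; lia.
  - move=> x Ax; rewrite /d lez_nat; apply: sorted_geq_nth => //.
    by move: Ax; rewrite /A sz; lia.
  - move=> x nAx; rewrite /d lez_nat; apply: sorted_geq_nth => //.
    by move: nAx; rewrite /A sz; have := ltn_ord x; lia.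
have [e' [e'C e'irr e'sum e'A]] := margins_symmetric margM MA kE.
exists e'; last exact: e'A.
split=> //; split=> // i; have := e'sum i; rewrite sum_deg /d => - []; exact.
Qed.

Local Close Scope ring_scope.

Lemma complete_subgraph (N s : nat) (e : rel 'I_N) :
  s <= N -> (forall i j : 'I_N, i < s -> j < s -> i != j -> e i j) ->
  subgraph (complete_graph s) e.
Proof.
move=> sN eA; exists (widen_ord sN); split; first by move=> i j [/ord_inj].
by move=> i j ij; apply: eA => //=.
Qed.

Lemma star_subgraph (V : finType) (t : nat) (e : rel V) (x : V) :
  simple_graph e -> t.-1 <= deg e x -> subgraph (star_graph t) e.
Proof.
move=> [eC eirr] deg_ge; pose s := enum [pred y | e x y].
have ss : size s = deg e x by rewrite -cardE.
have es i : i < size s -> e x (nth x s i).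
  by move=> /(mem_nth x); rewrite mem_enum inE.
(* The centre goes to [x] and leaf [k.+1] to the neighbour of index [k]. *)
pose f (i : 'I_t) := if val i is k.+1 then nth x s k else x.
have lt_s (i : 'I_t) k : val i = k.+1 -> k < size s.
  by move=> ik; have := ltn_ord i; rewrite ss; move: ik => /=; lia.
exists f; split=> [i j|i j].
- rewrite /f; case iE: (val i) => [|k]; case jE: (val j) => [|l].
  + by move=> _; apply: val_inj; rewrite iE jE.
  + by move=> xE; have := es l (lt_s _ _ jE); rewrite -xE (negbTE (eirr x)).
  + by move=> xE; have := es k (lt_s _ _ iE); rewrite xE (negbTE (eirr x)).
  + move/eqP; rewrite nth_uniq ?enum_uniq ?(lt_s _ _ iE) ?(lt_s _ _ jE) // => /eqP kl.
    by apply: val_inj; rewrite iE jE kl.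
- rewrite /star_graph /f => /andP[ij].
  case iE: (val i) => [|k]; case jE: (val j) => [|l] //=.
  + by move: ij; rewrite (_ : i = j) ?eqxx //; apply: val_inj; rewrite iE jE.
  + by move=> _; apply: es; exact: lt_s jE.
  + by move=> _; rewrite eC; apply: es; exact: lt_s iE.
Qed.

Lemma star_subgraph_deg (V : finType) (t : nat) (e : rel V) :
  0 < t -> subgraph (star_graph t) e -> exists x, t.-1 <= deg e x.
Proof.
case: t => // t _ [f [f_inj fe]]; exists (f ord0) => /=.
have card_im : #|[set f (lift ord0 i) | i : 'I_t]| = t.
  by rewrite card_imset ?card_ord // => i j /f_inj/lift_inj.
rewrite -[X in X <= _]card_im; apply: subset_leq_card.
by apply/subsetP => _ /imsetP[i _ ->]; rewrite inE fe //.
Qed.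

Lemma deg_compl (V : finType) (e : rel V) (x : V) :
  simple_graph e -> #|[pred y | (x != y) && ~~ e x y]| = #|V|.-1 - deg e x.
Proof.
move=> [eC eirr]; have := cardC (pred1 x); rewrite card1 => <-.
rewrite add1n /= -(cardID [pred y | e x y] (predC (pred1 x))) /deg.
rewrite [X in X + _](_ : _ = #|[pred y | e x y]|).
  by rewrite addKn; apply: eq_card => y; rewrite !inE eq_sym andbC.
apply: eq_card => y; rewrite !inE andbC.
by case: (y =P x) => [->|_]; rewrite ?(negbTE (eirr x)) ?andbT.
Qed.

Lemma nth_compl_seq (N : nat) (pi : seq nat) (i : 'I_N) :
  size pi = N -> nth 0 (compl_seq N pi) i = N.-1 - nth 0 pi (rev_ord i).
Proof.
move=> sz; rewrite /compl_seq nth_rev size_map sz //.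
by rewrite (nth_map 0) //= sz; have := ltn_ord i; lia.
Qed.

(** Complementation reverses the order of the degrees, so the vertices are relabelled by
    [rev_ord]. *)
Lemma realizes_compl (N : nat) (e : rel 'I_N) (pi : seq nat) :
  realizes e pi ->
  realizes (fun x y => (x != y) && ~~ e (rev_ord x) (rev_ord y)) (compl_seq N pi).
Proof.
move=> [sz [[eC eirr] edeg]]; split; first by rewrite size_rev size_map.
split; first by split=> [x y|x]; rewrite ?eqxx // eC eq_sym.
move=> i; rewrite nth_compl_seq // -edeg -[X in X.-1 - _](card_ord N) -deg_compl //.
rewrite /deg -(card_image (can_inj (@rev_ordK N))); apply: eq_card => y.
rewrite !inE; apply/imageP/idP => [[z]|].
  by rewrite inE => /andP[iz ez] ->; rewrite ez (inj_eq (can_inj (@rev_ordK N))) iz.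
case/andP=> iy ey; exists (rev_ord y); rewrite ?rev_ordK // inE rev_ordK ey.
by rewrite andbT; apply: contraNneq iy => ->; rewrite rev_ordK.
Qed.

Lemma graphic_compl (N : nat) (pi : seq nat) : graphic N pi -> graphic N (compl_seq N pi).
Proof.
move=> [sz [srt [e re]]]; have re' := realizes_compl re.
split; first by case: re'.
split; last by eexists; exact: re'.
rewrite rev_sorted; apply: (homo_sorted (e := geq)) srt => a b /=; exact: leq_sub2l.
Qed.

(** * Sequences for the lower bound *)

Lemma not_rpot_prop (N s t : nat) (pi : seq nat) :
  0 < t -> graphic N pi -> (forall i : 'I_N, N.-1 - nth 0 pi i < t.-1) ->
  (forall e : rel 'I_N, realizes e pi -> ~ subgraph (complete_graph s) e) ->
  ~ rpot_prop (complete_graph s) (star_graph t) N.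
Proof.
move=> t0 gr small noK /(_ pi gr)[] [_ [e [re sub]]]; first exact: noK sub.
have [x] := star_subgraph_deg t0 sub; case: re => _ [_ ->]; case: gr => sz _.
by rewrite nth_compl_seq //; have := small (rev_ord x); lia.
Qed.

(** Join a clique on [q] vertices to an independent set on [N - q]. This structure is forced in
    every realization, so a clique has at most [q.+1 < s] vertices. *)
Lemma dominated_no_rpot (N s t : nat) :
  1 < s -> 1 < t -> N + 3 <= t + s -> ~ rpot_prop (complete_graph s) (star_graph t) N.
Proof.
move=> s1 t1 Nst; pose q := N - minn N t.-1.
have qs : q.+1 < s by rewrite /q; lia.
pose dd i := if i < q then N.-1 else q.
have nthE (i : 'I_N) : nth 0 (mkseq dd N) i = dd i by rewrite nth_mkseq.
apply: (@not_rpot_prop N s t (mkseq dd N)); first by lia.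
- split; first by rewrite size_mkseq.
  split.
    apply/(sortedP 0) => i; rewrite size_mkseq => iN.
    rewrite !nth_mkseq //; last exact: ltnW.
    by rewrite /dd /=; case: ifP; case: ifP; lia.
  exists (fun x y : 'I_N => (x != y) && ((x < q) || (y < q))).
  split; first by rewrite size_mkseq.
  split; first by split=> [x y|x]; rewrite ?eqxx // eq_sym orbC.
  move=> i; rewrite nthE /deg /dd; case: ifP => iq.
    rewrite -[X in X.-1](card_ord N) -(cardC1 i).
    by apply: eq_card => y; rewrite !inE andbT eq_sym.
  have qN : q <= N by rewrite /q; lia.
  transitivity #|[set widen_ord qN k | k : 'I_q]|; last first.
    by rewrite card_imset ?card_ord // => a b [/ord_inj].
  apply: eq_card => y; rewrite !inE; apply/andP/imsetP => [[_ yq]|[k _ ->]].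
    by exists (Ordinal yq) => //; apply: ord_inj.
  split; last exact: (ltn_ord k).
  by apply: contraFneq iq => ->; exact: (ltn_ord k).
- by move=> i; rewrite nthE /dd /q; case: ifP; lia.
move=> e [sz [[eC eirr] edeg]] [f [f_inj fe]].
(* A vertex of degree [N.-1] is adjacent to all others, whatever the realization. *)
have dom (y x : 'I_N) : y < q -> y != x -> e y x.
  move=> yq yx; have /eqP := edeg y; rewrite nthE /dd yq => dy.
  have sub : [pred z | e y z] \subset predC1 y.
    by apply/subsetP => z; rewrite !inE; apply: contraTneq => ->.
  have /subset_leqif_card[_] := sub; rewrite cardC1 card_ord -/(deg e y) dy.
  by move=> /esym/subsetP/(_ x); rewrite !inE eq_sym; exact.
pose B := [set a : 'I_s | q <= f a].
have /card_gt1P[a [b [aB bB ab]]] : 1 < #|B|.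
  have := cardsC B; rewrite card_ord.
  have : #|~: B| <= q.
    rewrite -[X in _ <= X]card_ord.
    have lt_q (x : {a | a \in ~: B}) : f (val x) < q.
      by have := valP x; rewrite !inE -ltnNge.
    rewrite -(card_sig (mem (~: B))).
    pose g x := Ordinal (lt_q x).
    rewrite -(card_codom (f := g)) ?max_card // => x y [/ord_inj/f_inj].
    exact: val_inj.
  lia.
move: aB bB; rewrite !inE => fa fb.
have := edeg (f a); rewrite nthE /dd ltnNge fa /= => da.
have qN : q <= N by rewrite /q; lia.
(* Two clique vertices outside the dominating part: [f a] has degree [q], yet is adjacent to the [q]
   dominating vertices and to [f b]. *)
have : #|f b |: [set widen_ord qN k | k : 'I_q]| <= deg e (f a).
  apply: subset_leq_card; apply/subsetP => y; rewrite !inE.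
  case/orP=> [/eqP->|/imsetP[k _ ->]]; first by apply: fe.
  rewrite eC; apply: dom; first exact: (ltn_ord k).
  by apply: contraTneq fa => <-; rewrite -ltnNge; exact: (ltn_ord k).
rewrite da cardsU1 card_imset ?card_ord => [|x y [/ord_inj] //].
suff -> : f b \notin [set widen_ord qN k | k : 'I_q] by rewrite ltnn.
apply: contraTN fb => /imsetP[k _ ->]; rewrite -ltnNge; exact: (ltn_ord k).
Qed.

Lemma ordS_neq_pred (N : nat) (x : 'I_N) : 2 < N -> uniq [:: x; ordS x; ord_pred x].
Proof.
move=> N2; have vS (y : 'I_N) : ordS y = (if y.+1 == N then 0 else y.+1) :> nat.
  by rewrite /=; case: eqP => [->|yN]; rewrite ?modnn // modn_small //; have := ltn_ord y; lia.
have Sneq (y : 'I_N) : ordS y != y.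
  by apply/eqP => /(congr1 (@nat_of_ord _)); rewrite vS; have := ltn_ord y; case: eqP => //; lia.
have SSneq (y : 'I_N) : ordS (ordS y) != y.
  apply/eqP => /(congr1 (@nat_of_ord _)); rewrite !vS; have := ltn_ord y.
  by case: (y.+1 =P N) => //; case: eqP => //=; lia.
rewrite /= !inE negb_or andbT eq_sym Sneq /=; apply/andP; split.
  by apply: contraNneq (Sneq (ord_pred x)) => E; rewrite ord_predK -E.
apply: contraNneq (SSneq (ord_pred x)) => E.
by rewrite ord_predK E.
Qed.

(** The constant sequence [N - 3] is realized by the complement of a cycle. In any realization the
    complement is 2-regular, too sparse for a star with at least three leaves. *)
Lemma cycle_no_rpot (N s t : nat) :
  3 < t -> 2 < N -> N < 2 * s -> ~ rpot_prop (complete_graph s) (star_graph t) N.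
Proof.
move=> t3 N2 Ns.
have nthE (i : 'I_N) : nth 0 (nseq N (N - 3)) i = N - 3 by rewrite nth_nseq ltn_ord.
apply: (@not_rpot_prop N s t (nseq N (N - 3))); first by lia.
- split; first by rewrite size_nseq.
  split.
    apply/(sortedP 0) => i; rewrite size_nseq => iN.
    by rewrite !nth_nseq iN (ltnW iN) /=.
  exists (fun x y : 'I_N => [&& x != y, y != ordS x & x != ordS y]).
  split; first by rewrite size_nseq.
  split; first by split=> [x y|x]; rewrite ?eqxx // eq_sym; congr (_ && _); rewrite andbC.
  move=> i; rewrite nthE /deg; have /card_uniqP := ordS_neq_pred i N2.
  have := cardC (mem [:: i; ordS i; ord_pred i]); rewrite card_ord => cE sE.
  rewrite -[N in RHS]cE sE addKn; apply: eq_card => y.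
  rewrite !inE !negb_or -[y == ord_pred i](inj_eq (can_inj (@ordSK N))) ord_predK.
  by rewrite [y == i]eq_sym [ordS y == i]eq_sym.
- by move=> i; rewrite nthE; lia.
move=> e [sz [sg edeg]] [f [f_inj fe]].
pose A := f @: [set: 'I_s].
have cardA : #|A| = s by rewrite card_imset // cardsT card_ord.
pose n x y := (x != y) && ~~ e x y.
have nsum x : \sum_y n x y = 2.
  rewrite -(_ : #|[pred y | n x y]| = 2).
    by rewrite -sum1_card [RHS]big_mkcond; apply: eq_bigr => y _; rewrite inE; case: (n x y).
  by rewrite deg_compl // card_ord edeg nthE; lia.
have nC x y : n x y = n y x by case: sg => eC _; rewrite /n eq_sym eC.
(* Both non-neighbours of a clique vertex lie outside the clique; counting these non-edges from the
   other side gives [2 * s <= 2 * (N - s)]. *)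
have outA x : x \in A -> \sum_(y in ~: A) n x y = 2.
  move=> xA; rewrite -(nsum x) [RHS](bigID (mem A)) /= [X in _ = X + _]big1 ?add0n.
    by apply: eq_bigl => y; rewrite inE.
  move=> y; case/imsetP: xA => a _ ->; case/imsetP => b _ ->.
  by rewrite /n; case: eqP => //= fab; rewrite fe //; apply: contra_notN fab => /eqP->.
have : \sum_(x in A) \sum_(y in ~: A) n x y <= \sum_(y in ~: A) 2.
  rewrite exchange_big; apply: leq_sum => y _; rewrite -(nsum y).
  by rewrite [X in _ <= X](bigID (mem A)) /=; under eq_bigr do rewrite nC; exact: leq_addr.
rewrite (eq_bigr (fun=> 2)) // !sum_nat_const.
by have := cardsC A; rewrite card_ord cardA; lia.
Qed.

(** * Combination of the two bounds *)

Theorem theorem5 (s t : nat) : 4 <= s -> 4 <= t ->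
  is_rpot (complete_graph s) (star_graph t) (if t < s + 2 then 2 * s else t + s - 2).
Proof.
move=> s4 t4; set N := if _ then _ else _.
have sN : 2 * s <= N by rewrite /N; case: ifP; lia.
have stN : t + s - 2 <= N by rewrite /N; case: ifP; lia.
split; last first.
  move=> N' rN'; rewrite leqNgt; apply/negP => ltN.
  (* In the second case [N'] is at least [t + s - 2], so [N' < N] is possible only when [N] is
     [2 * s], and the cycle applies. *)
  have [small|large] := leqP (N' + 3) (t + s).
    by apply: (@dominated_no_rpot N' s t) rN' => //; lia.
  apply: (@cycle_no_rpot N' s t) rN' => //; first by lia.
  by move: ltN; rewrite /N; case: ifP; lia.
move=> pi gr; have [sz [srt [e re]]] := gr.
have [/existsP[i bigi]|small] := boolP [exists i : 'I_N, t.-1 <= N.-1 - nth 0 pi i].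
  right; split; first exact: graphic_compl.
  have re' := realizes_compl re; eexists; split; first exact: re'.
  case: re' => _ [sg dE]; apply: (star_subgraph (x := rev_ord i)) => //.
  by rewrite dE nth_compl_seq // rev_ordK.
left; split=> //.
(* Fewer than [t.-1] non-neighbours on at least [t + s - 2] vertices leave at least [s.-1]
   neighbours. *)
have dmin (i : 'I_N) : s.-1 <= nth 0 pi i.
  move: small; rewrite negb_exists => /forallP/(_ i).
  by have := ltn_ord i; move: stN; lia.
have [|e' re' e'A] := realizes_clique re srt sN _ dmin; first by lia.
exists e'; split=> //; apply: complete_subgraph => //; lia.
Qed.
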